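(* The space $\mathcal{M}_{NA}(\mathbb{R}^n)$ of negatively associated probability measures on $\mathbb{R}^n$ is not convex.
   Context: A function $f:\mathbb{R}^m\to\mathbb{R}$ is non-decreasing if $f(x)\ge f(y)$ whenever $x\ge y$ coordinatewise. For $I\subset\{1,\dots,n\}$, $x_I\in\mathbb{R}^{|I|}$ is the restriction of $x\in\mathbb{R}^n$ to the coordinates in $I$. A Borel probability measure $\mu$ on $\mathbb{R}^n$ is negatively associated (NA) if for all disjoint $I,J\subset\{1,\dots,n\}$ and all non-decreasing integrable $f:\mathbb{R}^{|I|}\to\mathbb{R}$, $g:\mathbb{R}^{|J|}\to\mathbb{R}$, $$\int f(x_I)g(x_J)\,d\mu(x)\le\int f(x_I)\,d\mu(x)\int g(x_J)\,d\mu(x).$$ Convexity is with respect to convex combinations $\lambda\mu+(1-\lambda)\nu$, $0\le\lambda\le1$, of measures. *)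

(* Defs.v *)
From HB Require Import structures.
From mathcomp Require Import all_boot all_order all_algebra.
From mathcomp Require Import all_classical all_reals all_analysis.

Set Implicit Arguments.
Unset Strict Implicit.
Unset Printing Implicit Defensive.

Import Order.TTheory GRing.Theory Num.Theory.
Import numFieldNormedType.Exports.

Local Open Scope classical_set_scope.
Local Open Scope ring_scope.

(* R^n with the Borel sigma-algebra, i.e., the one generated by the open sets
   of the usual topology of R^n. *)
Definition borel_rV (R : realType) (n : nat) : measurableType _ :=
  g_sigma_algebraType (@open 'rV[R]_n).

(* enum_val lists the elements of I : {set 'I_n} in increasing order. *)
Definition restr (R : realType) (n : nat) (I : {set 'I_n}) (x : 'rV[R]_n) :
    'rV[R]_#|I| :=
  \row_(i < #|I|) x 0 (enum_val i).

Definition coord_nondecreasing (R : realType) (m : nat) (f : 'rV[R]_m -> R) :=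
  forall x y : 'rV[R]_m, (forall i, y 0 i <= x 0 i) -> f y <= f x.

(* Integrals take values in \bar R: the product f(x_I) g(x_J) of integrable
   functions need not be integrable. The clash oo - oo, which evaluates to -oo
   and so satisfies the inequality, is harmless: if the positive part of
   f(x_I) g(x_J) has infinite integral, then so does f^+ g^+ or f^- g^-, and the
   inequality fails for (f^+, g^+) or for (- f^-, - g^-), which are again
   nondecreasing and integrable. *)
Definition negatively_associated (R : realType) (n : nat)
    (mu : probability (borel_rV R n) R) :=
  forall (I J : {set 'I_n}) (f : 'rV[R]_#|I| -> R) (g : 'rV[R]_#|J| -> R),
    [disjoint I & J]%B ->
    coord_nondecreasing f -> coord_nondecreasing g ->
    mu.-integrable [set: borel_rV R n] (fun x => (f (restr I x))%:E) ->
    mu.-integrable [set: borel_rV R n] (fun x => (g (restr J x))%:E) ->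
    (\int[mu]_x (f (restr I x) * g (restr J x))%:E <=
     \int[mu]_x (f (restr I x))%:E * \int[mu]_x (g (restr J x))%:E)%E.

Definition M_NA (R : realType) (n : nat) : set (probability (borel_rV R n) R) :=
  [set mu | negatively_associated mu].

Section convex_combination.
Context d (T : measurableType d) (R : realType).
Variables (t : {i01 R}) (mu nu : probability T R).

Definition mconv : set T -> \bar R :=
  measure_add (mscale (t%:num)%:nng mu) (mscale (1 - t%:num)%:nng nu).

HB.instance Definition _ := Measure.on mconv.

Lemma mconvE (A : set T) :
  mconv A = ((t%:num)%:E * mu A + (1 - t%:num)%:E * nu A)%E.
Proof. by rewrite /mconv measure_addE. Qed.

Let mconv_setT : mconv setT = 1%E.
Proof.
by rewrite mconvE !probability_setT !mule1 -EFinD subrKC.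
Qed.

HB.instance Definition _ := Measure_isProbability.Build _ _ _ mconv mconv_setT.

End convex_combination.

Definition convex_prob_set d (T : measurableType d) (R : realType)
    (A : set (probability T R)) :=
  forall (t : {i01 R}) (mu nu : probability T R),
    A mu -> A nu -> A (mconv t mu nu).

(* Main.v *)
Require Import Defs.
From mathcomp Require Import all_boot all_order all_algebra.
From mathcomp Require Import all_classical all_reals all_analysis.
From mathcomp Require Import lra.

(** Every point mass is negatively associated, since integrating against the
    point mass at [p] is evaluation at [p], which is multiplicative; so the
    defining inequality is an equality.  The midpoint of the point masses at
    [(0, ..., 0)] and [(1, ..., 1)], on the other hand, is the law of a vector
    whose coordinates are all equal to one fair coin, which is as positively
    correlated as can be.  Testing negative association on the increasing
    indicators of [x_i > 0] and [x_j > 0] for two distinct coordinates [i], [j]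
    ([negatively_associated_orthant]) would give [1/2 <= 1/2 * 1/2]. *)

Import Order.TTheory GRing.Theory Num.Theory.
Import numFieldNormedType.Exports.

Local Open Scope classical_set_scope.
Local Open Scope ring_scope.

Definition positive_halfspace (R : realType) (n : nat) (i : 'I_n) :
    set (borel_rV R n) :=
  [set x : 'rV[R]_n | 0 < x 0 i].

Lemma measurable_positive_halfspace (R : realType) (n : nat) (i : 'I_n) :
  measurable (positive_halfspace R n i).
Proof.
apply: sub_sigma_algebra.
apply: (@open_comp 'rV[R]_n R (fun x => x 0 i) [set r | 0 < r]).
  by move=> x _; exact: coord_continuous.
exact: open_gt.
Qed.

(** Stated in every dimension [m] because the test functions of negative
    association live on a space whose dimension is the cardinal of an index
    set; for a one-element index set it is the indicator of a half-line. *)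
Definition orthant_indicator (R : realType) (m : nat) (y : 'rV[R]_m) : R :=
  \1_[set z : 'rV[R]_m | forall k, 0 < z 0 k] y.

Lemma orthant_indicator_nondecreasing (R : realType) (m : nat) :
  coord_nondecreasing (@orthant_indicator R m).
Proof.
move=> x y yx; rewrite /orthant_indicator !indicE ler_nat.
have [/set_mem ypos|_] := boolP (y \in _); last by [].
by rewrite mem_set// => k; apply: lt_le_trans (yx k); exact: ypos.
Qed.

Lemma orthant_indicator_restr1 (R : realType) (n : nat) (i : 'I_n)
    (x : 'rV[R]_n) :
  orthant_indicator R _ (restr [set i]%SET x) = \1_(positive_halfspace R n i) x.
Proof.
rewrite /orthant_indicator !indicE; congr (_%:R); congr nat_of_bool.
apply/idP/idP => /set_mem /= xpos; apply/mem_set => /=.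
- have i1 : i \in [set i]%SET by rewrite inE.
  by have := xpos (enum_rank_in i1 i); rewrite mxE enum_rankK_in.
- by move=> k; rewrite mxE; have := enum_valP k; rewrite inE => /eqP ->.
Qed.

(** With indicators as test functions every integral is the measure of a set,
    so that for a mixture it can be read off from the mixed measures; bounded
    test functions are moreover integrable for every probability. *)
Lemma negatively_associated_orthant (R : realType) (n : nat)
    (mu : probability (borel_rV R n) R) (i j : 'I_n) :
  negatively_associated mu -> i != j ->
  (mu (positive_halfspace R n i `&` positive_halfspace R n j) <=
   mu (positive_halfspace R n i) * mu (positive_halfspace R n j))%E.
Proof.
move=> NA ij.
have mH := measurable_positive_halfspace R n.
have restrE k : (fun x : borel_rV R n =>
    (orthant_indicator R _ (restr [set k]%SET x))%:E) =
    (fun x => (\1_(positive_halfspace R n k) x)%:E).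
  by apply/funext => x; rewrite orthant_indicator_restr1.
have intH k : (\int[mu]_x (\1_(positive_halfspace R n k) x)%:E =
    mu (positive_halfspace R n k))%E.
  by rewrite integral_indic// setIT.
have prodE : (fun x : borel_rV R n =>
    (orthant_indicator R _ (restr [set i]%SET x) *
     orthant_indicator R _ (restr [set j]%SET x))%:E) =
    (fun x =>
      (\1_(positive_halfspace R n i `&` positive_halfspace R n j) x)%:E).
  by apply/funext => x; rewrite !orthant_indicator_restr1 indicI.
have := NA [set i]%SET [set j]%SET _ _ _
  (orthant_indicator_nondecreasing R _) (orthant_indicator_nondecreasing R _).
rewrite prodE !restrE !intH integral_indic//; last exact: measurableI.
rewrite setIT; apply.
- by rewrite disjoints1 inE.
- exact: integrable_indic.
- exact: integrable_indic.
Qed.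

Lemma negatively_associated_dirac (R : realType) (n : nat)
    (p : borel_rV R n) :
  negatively_associated (\d_p : probability (borel_rV R n) R).
Proof.
move=> I J f g _ _ _ /measurable_int mf /measurable_int mg.
under eq_integral do rewrite EFinM.
rewrite !integral_dirac//; last exact: emeasurable_funM.
by rewrite diracT !mul1e.
Qed.

Theorem theorem2 (R : realType) (n : nat) (hn : (2 <= n)%N) :
  ~ convex_prob_set (@M_NA R n).
Proof.
move=> cvx.
pose i : 'I_n := Ordinal (ltnW hn); pose j : 'I_n := Ordinal hn.
have half01 : 0 <= (2^-1 : R) <= 1 by rewrite invr_ge0 ler0n invf_le1 ?ler1n.
case/andP: half01 => half0 half1.
pose zero : borel_rV R n := (0 : 'rV[R]_n).
pose one : borel_rV R n := (const_mx 1 : 'rV[R]_n).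
have := cvx (Itv01 half0 half1) (\d_zero) (\d_one)
  (negatively_associated_dirac R n zero) (negatively_associated_dirac R n one).
move=> /negatively_associated_orthant /(_ (isT : i != j)).
set Hi := positive_halfspace R n i; set Hj := positive_halfspace R n j.
have mixE (A : set (borel_rV R n)) :
    mconv (Itv01 half0 half1) (\d_zero) (\d_one) A =
    (2^-1%:E * \d_zero A + (1 - 2^-1)%:E * \d_one A)%E by exact: mconvE.
rewrite [leLHS]mixE [X in (_ <= X * _)%E]mixE [X in (_ <= _ * X)%E]mixE.
have zeroN k : (zero \in positive_halfspace R n k) = false.
  by apply/negbTE/negP => /set_mem; rewrite /positive_halfspace/= mxE ltxx.
have oneH k : one \in positive_halfspace R n k.
  by apply/mem_set; rewrite /positive_halfspace/= mxE ltr01.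
rewrite !diracE !in_setI !zeroN !oneH /= !mule0 !add0e !mule1.
rewrite -EFinM lee_fin leNgt => /negP; apply.
lra.
Qed.
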